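(* Let $1\le p<2$, $N\in\mathbb N$, $d,n\ge1$, let $f=(f_1,\dots,f_d)$ be vector fields on $\mathbb R^n$ of class $C^1_b$, let $\mathbf w=(\mathbf w_0,\dots,\mathbf w_N)$ be a time series in $\mathbb R^d$, and let $\mathbf x$ solve $\mathbf x_{k+1}=\mathbf x_k+\sum_{\mu=1}^df_\mu(\mathbf x_k)(\mathbf w^\mu_{k+1}-\mathbf w^\mu_k)$, $\mathbf x_0=\xi\in\mathbb R^n$. Then for all $0\le k<l\le N$, \[ \|\mathbf x\|_{p;[k,l]}\le 2\Big(2^pC_{p,N}^{p-1}\|f\|^p_{C^1_b}\|\mathbf w\|^p_{p;[k,l]}\ \vee\ 2\|f\|_{C^1_b}\|\mathbf w\|_{p;[k,l]}\Big), \] where $C_{p,N}\coloneqq 2^{2/p}\zeta_N(2/p)$ and $\zeta_N(s)=\sum_{j=1}^Nj^{-s}$.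
   Context: $\mathbb R^n$ carries a fixed norm, $\mathbb R^d$ the $\ell^1$ norm; derivatives use operator norms. $\|f\|_{C^1_b}\coloneqq\max_\mu\max(\|f_\mu\|_\infty,\|Df_\mu\|_\infty)$. For $0\le k<l\le N$, $\mathcal S_{k,l}$ is the set of increasing integer sequences $s=(s_0=k<s_1<\dots<s_m<s_{m+1}=l)$, $\#s=m$, and $\|\mathbf w\|_{p;[k,l]}\coloneqq(\max_{s\in\mathcal S_{k,l}}\sum_{j=0}^{\#s}|\mathbf w_{s_{j+1}}-\mathbf w_{s_j}|^p)^{1/p}$; $a\vee b=\max(a,b)$. *)

(* Defs.v *)
From HB Require Import structures.
From mathcomp Require Import all_boot all_order all_algebra.
From mathcomp Require Import all_classical all_reals.
From mathcomp Require Import topology normedtype derive exp.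
Set Implicit Arguments. Unset Strict Implicit. Unset Printing Implicit Defensive.
Import Order.TTheory GRing.Theory Num.Theory.
Import numFieldNormedType.Exports.
Local Open Scope classical_set_scope.
Local Open Scope ring_scope.

Section Defs.
Variable R : realType.

Definition is_norm (V : lmodType R) (nrm : V -> R) : Prop :=
  [/\ forall x y, nrm (x + y) <= nrm x + nrm y,
      forall (a : R) x, nrm (a *: x) = `|a| * nrm x
    & forall x, nrm x = 0 -> x = 0].

Definition l1norm (d : nat) (v : 'rV[R]_d) : R := \sum_(i < d) `|v ord0 i|.

Definition incr_seq (k l : nat) (s : seq nat) : bool := path ltn k (rcons s l).

Definition pvar_sum (V : zmodType) (nm : V -> R) (p : R) (w : nat -> V)
  (k l : nat) (s : seq nat) : R :=
  let pts := k :: rcons s l in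
  \sum_(j < (size s).+1) (nm (w (nth 0%N pts j.+1) - w (nth 0%N pts j))) `^ p.

(* ||w||_{p;[k,l]} : the maximum over the finite set S_{k,l} (written as sup) *)
Definition pvar (V : zmodType) (nm : V -> R) (p : R) (w : nat -> V)
  (k l : nat) : R :=
  (sup [set pvar_sum nm p w k l s | s in [set s | incr_seq k l s]]) `^ p^-1.

Definition opnorm (n : nat) (nrm : 'rV[R]_n -> R) (L : 'rV[R]_n -> 'rV[R]_n) : R :=
  sup [set nrm (L v) | v in [set v | nrm v <= 1]].

Definition supnorm (n : nat) (nrm : 'rV[R]_n -> R) (g : 'rV[R]_n -> 'rV[R]_n) : R :=
  sup [set nrm (g x) | x in setT].

Definition dsupnorm (n : nat) (nrm : 'rV[R]_n -> R) (g : 'rV[R]_n -> 'rV[R]_n) : R :=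
  sup [set opnorm nrm ('d g x : 'rV[R]_n -> 'rV[R]_n) | x in setT].

(* g is C^1_b : C^1 (differentiable with continuous derivative; in finite
   dimension continuity of x |-> Dg(x) is continuity of each x |-> Dg(x) v),
   with g and Dg bounded *)
Definition C1b (n : nat) (nrm : 'rV[R]_n -> R) (g : 'rV[R]_n -> 'rV[R]_n) : Prop :=
  [/\ forall x, differentiable g x,
      forall v, continuous (fun x => ('d g x : 'rV[R]_n -> 'rV[R]_n) v),
      exists M, forall x, nrm (g x) <= M
    & exists M, forall x v, nrm ('d g x v) <= M * nrm v].

Definition C1b_norm (n d : nat) (nrm : 'rV[R]_n -> R)
  (f : 'I_d -> 'rV[R]_n -> 'rV[R]_n) : R :=
  \big[Num.max/0]_(mu < d) Num.max (supnorm nrm (f mu)) (dsupnorm nrm (f mu)).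

Definition zetaN (N : nat) (s : R) : R := \sum_(1 <= j < N.+1) (j%:R) `^ (- s).

Definition CpN (p : R) (N : nat) : R := 2 `^ (2 / p) * zetaN N (2 / p).

End Defs.

(* Main.v *)
Require Import Defs.
From HB Require Import structures.
From mathcomp Require Import all_boot all_order all_algebra.
From mathcomp Require Import all_classical all_reals.
From mathcomp Require Import topology normedtype derive exp.
From mathcomp Require Import interval_inference convex hoelder lra ring zify.
Set Implicit Arguments. Unset Strict Implicit. Unset Printing Implicit Defensive.
Import Order.TTheory GRing.Theory Num.Theory.
Import numFieldNormedType.Exports.
Local Open Scope classical_set_scope.
Local Open Scope ring_scope.

(* Let [X] and [W] be the [p]-variations of [x] and [w], and [F] the [C^1_b] norm
   of [f]. Both are [p]-controls: nonnegative functions of an interval whose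
   [p]-th power is superadditive; and the [p]-variation is the least [p]-control
   dominating the increments. The remainder
   [x_b - x_a - sum_mu f_mu(x_a) (w_b - w_a)^mu] vanishes on unit steps, and its
   additivity defect on [a < b < c] is at most [F X(a,c) W(a,c)], which is a
   [p/2]-control by Hoelder's inequality. Young's argument, removing the points of
   a partition one at a time, always one that costs little, bounds the remainder
   by [C F X W], where [C] is the constant [C_{p,N}]. Hence [X <= F (1 + C X) W] on
   every interval, so that [C X <= Om := 2 C F W] wherever [Om <= 1]. Cutting a
   general interval into blocks on which [Om] just exceeds 1, subadditivity of [X]
   and superadditivity of [Om^p] give [C X <= 2 Om^p]. *)

Section PowR.
Variable R : realType.
Implicit Types (p q a b A B : R).

Lemma gt0_ler_powR2r p a b : 0 < p -> 0 <= a -> 0 <= b ->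
  (a `^ p <= b `^ p) = (a <= b).
Proof. by move=> p0 a0 b0; apply: (le_mono_in (gt0_ltr_powR p0)). Qed.

Lemma powRVK p a : p != 0 -> 0 <= a -> (a `^ p^-1) `^ p = a.
Proof. by move=> p0 a0; rewrite -powRrM mulVf// powRr1. Qed.

Lemma powRrM_divK p q a : p != 0 -> (a `^ p) `^ (q / p) = a `^ q.
Proof. by move=> p0; rewrite -powRrM mulrCA mulfV// mulr1. Qed.

Lemma powR_div p a b : 0 <= a -> 0 <= b -> (a / b) `^ p = a `^ p / b `^ p.
Proof.
move=> a0 b0; rewrite powRM ?invr_ge0//; congr (_ * _).
by rewrite -powR_inv1// -powRrM mulN1r powRN.
Qed.

Lemma ler_powR_root q (m c a b : R) :
  0 < q -> 0 < m -> 0 <= c -> 0 <= a -> 0 <= b ->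
  m * a `^ q <= c * b `^ q -> a <= c `^ q^-1 * m `^ (- q^-1) * b.
Proof.
move=> q0 m0 c0 a0 b0 le_ab; have qn0 : q != 0 by rewrite gt_eqF.
rewrite -(gt0_ler_powR2r q0) ?mulr_ge0 ?powR_ge0// !powRM ?mulr_ge0 ?powR_ge0//.
rewrite powRVK// -powRrM mulNr mulVf// powR_inv1 ?(ltW m0)// mulrAC.
by rewrite ler_pdivlMr// mulrC.
Qed.

Lemma ler_powR_conv p t a b : 1 <= p -> 0 <= t <= 1 -> 0 <= a -> 0 <= b ->
  (t * a + (1 - t) * b) `^ p <= t * a `^ p + (1 - t) * b `^ p.
Proof.
move=> p1 /andP[t0 t1] a0 b0.
have mem c : 0 <= c -> c \in (`[0, +oo[%classic : set R).
  by move=> c0; rewrite inE/= in_itv/= c0.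
exact: (convex_powR p1 (Itv01 t0 t1) (mem a a0) (mem b b0)).
Qed.

Lemma powRD_le0 p a b : p != 0 -> a `^ p + b `^ p <= 0 `^ p -> a = 0 /\ b = 0.
Proof.
move=> p0; have := powR_ge0 a p; have := powR_ge0 b p.
by rewrite powR0// => b0 a0 le0; split; apply: (@powR_eq0_eq0 _ _ p); lra.
Qed.

Lemma powRD_le_conv p a b A B : 1 <= p ->
  0 <= a -> 0 <= b -> 0 < A -> 0 < B ->
  (a + b) `^ p <= (A + B) `^ p *
    (A / (A + B) * (a `^ p / A `^ p) + B / (A + B) * (b `^ p / B `^ p)).
Proof.
move=> p1 a0 b0 A0 B0; have AB0 : 0 < A + B by exact: addr_gt0.
have BE : B / (A + B) = 1 - A / (A + B) by field; rewrite gt_eqF.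
have t0 : 0 <= A / (A + B) by rewrite divr_ge0 ?(ltW A0) ?(ltW AB0).
have t1 : A / (A + B) <= 1 by rewrite ler_pdivrMr// mul1r lerDl ltW.
have combE : a + b = (A + B) * (A / (A + B) * (a / A) + B / (A + B) * (b / B)).
  by field; rewrite !gt_eqF.
have aA0 : 0 <= a / A by rewrite divr_ge0// ltW.
have bB0 : 0 <= b / B by rewrite divr_ge0// ltW.
rewrite combE BE powRM ?(ltW AB0)//; last first.
  by apply: addr_ge0; apply: mulr_ge0; rewrite ?subr_ge0.
rewrite -!powR_div ?(ltW A0) ?(ltW B0)// ler_wpM2l ?powR_ge0//.
by rewrite ler_powR_conv// t0.
Qed.

Lemma powR_minkowski p a1 a2 b1 b2 A B : 1 <= p ->
  0 <= a1 -> 0 <= a2 -> 0 <= b1 -> 0 <= b2 -> 0 <= A -> 0 <= B ->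
  a1 `^ p + a2 `^ p <= A `^ p -> b1 `^ p + b2 `^ p <= B `^ p ->
  (a1 + b1) `^ p + (a2 + b2) `^ p <= (A + B) `^ p.
Proof.
move=> p1 a10 a20 b10 b20.
have p0 : p != 0 by rewrite gt_eqF// (lt_le_trans _ p1).
rewrite le_eqVlt => /predU1P[<- _ /(powRD_le0 p0)[-> ->]|A0].
  by rewrite !add0r.
rewrite le_eqVlt => /predU1P[<- + /(powRD_le0 p0)[-> ->]|B0].
  by rewrite !addr0.
have ratio_le1 a b c : 0 < c -> a `^ p + b `^ p <= c `^ p ->
    a `^ p / c `^ p + b `^ p / c `^ p <= 1.
  by move=> c0 le_c; rewrite -mulrDl ler_pdivrMr ?powR_gt0// mul1r.
move=> /(ratio_le1 _ _ _ A0) leA /(ratio_le1 _ _ _ B0) leB.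
apply: le_trans (lerD (powRD_le_conv p1 a10 b10 A0 B0)
  (powRD_le_conv p1 a20 b20 A0 B0)) _.
rewrite -mulrDr ler_piMr ?powR_ge0//.
have AB0 : 0 < A + B by exact: addr_gt0.
have wA0 : 0 <= A / (A + B) by rewrite divr_ge0 ?(ltW A0) ?(ltW AB0).
have wB0 : 0 <= B / (A + B) by rewrite divr_ge0 ?(ltW B0) ?(ltW AB0).
have w1 : A / (A + B) + B / (A + B) = 1 by rewrite -mulrDl divff ?gt_eqF.
have := ler_wpM2l wA0 leA; have := ler_wpM2l wB0 leB; lra.
Qed.

End PowR.

Definition superadditive (R : numDomainType) (om : nat -> nat -> R) : Prop :=
  forall a b c, (a <= b)%N -> (b <= c)%N -> om a b + om b c <= om a c.

Section Controls.
Variable R : realType.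
Implicit Types (p q r : R) (f g : nat -> nat -> R).

(* The [p]-th root of a control, in the terminology of rough paths. *)
Definition pcontrol p f : Prop :=
  (forall a b, 0 <= f a b) /\ superadditive (fun a b => f a b `^ p).

Lemma pcontrol_ge0 p f a b : pcontrol p f -> 0 <= f a b.
Proof. by case. Qed.

Lemma pcontrol_diag p f a : 0 < p -> pcontrol p f -> f a a = 0.
Proof.
move=> p0 [_ /(_ a a a (leqnn a) (leqnn a))]; have := powR_ge0 (f a a) p.
by move=> ge0 le0; apply: (@powR_eq0_eq0 _ _ p); lra.
Qed.

Lemma pcontrol_mono p f k a b l : 0 < p -> pcontrol p f ->
  (k <= a)%N -> (a <= b)%N -> (b <= l)%N -> f a b <= f k l.
Proof.
move=> p0 [f0 fS] ka ab bl; rewrite -(gt0_ler_powR2r p0)//.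
have := fS k a l ka (leq_trans ab bl); have := fS a b l ab bl.
have := powR_ge0 (f k a) p; have := powR_ge0 (f b l) p.
lra.
Qed.

Lemma pcontrolZ p f (c : R) : 0 <= c -> pcontrol p f ->
  pcontrol p (fun a b => c * f a b).
Proof.
move=> c0 [f0 fS]; split=> [a b|a b e ab be]; first exact: mulr_ge0.
by rewrite !powRM// -mulrDr ler_wpM2l ?powR_ge0// fS.
Qed.

Lemma pcontrol_homo p f (s : nat -> nat) : {homo s : a b / (a <= b)%N} ->
  pcontrol p f -> pcontrol p (fun a b => f (s a) (s b)).
Proof. by move=> sh [f0 fS]; split=> // a b c ab bc; apply: fS; apply: sh. Qed.

Lemma pcontrolD p f g : 1 <= p -> pcontrol p f -> pcontrol p g ->
  pcontrol p (fun a b => f a b + g a b).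
Proof.
move=> p1 [f0 fS] [g0 gS]; split=> [a b|a b c ab bc]; first exact: addr_ge0.
by apply: powR_minkowski => //; [exact: fS|exact: gS].
Qed.

(* Hoelder's inequality with the conjugate exponents [p / r] and [q / r]. *)
Lemma pcontrolM p q r f g : 0 < p -> 0 < q -> r^-1 = p^-1 + q^-1 ->
  pcontrol p f -> pcontrol q g -> pcontrol r (fun a b => f a b * g a b).
Proof.
move=> p0 q0 rE [f0 fS] [g0 gS]; split=> [a b|a b c ab bc].
  exact: mulr_ge0.
have r0 : 0 < r by rewrite -invr_gt0 rE addr_gt0 ?invr_gt0.
have conj : (p / r)^-1 + (q / r)^-1 = 1.
  by rewrite !invf_div -mulrDr -rE mulfV ?gt_eqF.
rewrite !powRM//; apply: le_trans (hoelder2 _ _ _ _ _ _ conj) _;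
  rewrite ?powR_ge0 ?divr_gt0//.
rewrite !powRrM_divK ?gt_eqF// !invf_div.
have root (s : R) (h : nat -> nat -> R) :
    0 < s -> superadditive (fun a b => h a b `^ s) ->
    (h a b `^ s + h b c `^ s) `^ (r / s) <= h a c `^ r.
  move=> s0 hS; rewrite -(@powRrM_divK _ s r (h a c)) ?gt_eqF//.
  apply: ge0_ler_powR; rewrite ?nnegrE ?addr_ge0 ?powR_ge0//; last exact: hS.
  by rewrite divr_ge0// ltW.
by apply: ler_pM; rewrite ?powR_ge0 ?root.
Qed.

End Controls.

Section ChainSum.
Variable V : nmodType.
Implicit Types (g : nat -> nat -> V) (k l : nat) (t : seq nat).

Definition chain_sum g k t : V := \sum_(v <- pairmap g k t) v.

Lemma chain_sum_nil g k : chain_sum g k [::] = 0.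
Proof. exact: big_nil. Qed.

Lemma chain_sum_cons g k u t : chain_sum g k (u :: t) = g k u + chain_sum g u t.
Proof. exact: big_cons. Qed.

Lemma chain_sum_cat g k t1 t2 :
  chain_sum g k (t1 ++ t2) = chain_sum g k t1 + chain_sum g (last k t1) t2.
Proof. by rewrite /chain_sum pairmap_cat big_cat. Qed.

Lemma chain_sum_nth g k t : chain_sum g k t =
  \sum_(j < size t) g (nth 0%N (k :: t) j) (nth 0%N (k :: t) j.+1).
Proof.
rewrite /chain_sum (big_nth 0) size_pairmap big_mkord.
by apply: eq_bigr => j _; rewrite (nth_pairmap 0%N).
Qed.

Lemma chain_sum_iota g k m :
  chain_sum g k (iota k.+1 m) = \sum_(k <= i < k + m) g i i.+1.
Proof.
elim: m k => [|m IH] k; first by rewrite chain_sum_nil big_geq ?addn0.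
by rewrite chain_sum_cons IH addSnnS [RHS]big_ltn// addnS ltnS leq_addr.
Qed.

End ChainSum.

Lemma last_iota k m : last k (iota k.+1 m) = (k + m)%N.
Proof. by elim: m k => [|m IH] k /=; rewrite ?addn0// IH addSnnS. Qed.

Lemma path_ltn_le_last k t : path ltn k t -> (k <= last k t)%N.
Proof. by elim: t k => [|u t IH] k //= /andP[ku /IH]; exact/leq_trans/ltnW. Qed.

Lemma chain_sum_le_superadditive (R : numDomainType) (om g : nat -> nat -> R)
    (k l : nat) (t : seq nat) :
  superadditive om -> 0 <= om l l ->
  (forall a b, (k <= a)%N -> (a < b)%N -> (b <= l)%N -> g a b <= om a b) ->
  path ltn k t -> last k t = l -> chain_sum g k t <= om k l.
Proof.
move=> omS om0; elim: t k => [|u t IH] k g_le /=.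
  by move=> _ ->; rewrite chain_sum_nil.
move=> /andP[ku ut] tl; have ul : (u <= l)%N by rewrite -tl path_ltn_le_last.
rewrite chain_sum_cons; apply: le_trans (omS _ _ _ (ltnW ku) ul).
apply: lerD; first exact: g_le.
by apply: IH => // a b ua; apply: g_le; exact: leq_trans (ltnW ku) ua.
Qed.

Lemma chain_sum_bounded (R : numDomainType) (g : nat -> nat -> R) k l :
  (forall a b, 0 <= g a b) ->
  exists M, forall t, path ltn k t -> last k t = l -> chain_sum g k t <= M.
Proof.
move=> g0; pose om a b := \sum_(a <= i < b) \sum_(0 <= j < l.+1) g i j.
have om0 a b : 0 <= om a b by do 2![apply: sumr_ge0 => ? _].
have omS : superadditive om.
  by move=> a b c ab bc; rewrite /om [leRHS](big_cat_nat ab bc).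
exists (om k l) => t; apply: chain_sum_le_superadditive => // a b _ ab bl.
rewrite /om big_ltn// (bigD1_seq b) ?iota_uniq ?mem_index_iota ?ltnS//=.
by rewrite -addrA lerDl addr_ge0 ?sumr_ge0// => i _; rewrite sumr_ge0.
Qed.

Lemma sup_ge0 (R : realType) (A : set R) :
  (forall y, A y -> 0 <= y) -> 0 <= sup A.
Proof.
move=> A_ge0; have [[[y Ay] Aub]|/sup_out->//] := pselect (has_sup A).
exact: le_trans (A_ge0 y Ay) (ub_le_sup Aub Ay).
Qed.

Section PVariation.
Variables (R : realType) (V : zmodType) (nm : V -> R) (p : R).
Hypotheses (nm_ge0 : forall v, 0 <= nm v) (p_gt0 : 0 < p).
Implicit Types (w : nat -> V) (f : nat -> nat -> R) (k l : nat) (t : seq nat).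

Let pincr w a b := nm (w b - w a) `^ p.

Lemma pvar_sumE w k l s :
  pvar_sum nm p w k l s = chain_sum (pincr w) k (rcons s l).
Proof. by rewrite /pvar_sum chain_sum_nth size_rcons. Qed.

Lemma pvar_sums_has_ubound w k l :
  has_ubound [set pvar_sum nm p w k l s | s in [set s | incr_seq k l s]].
Proof.
have [M leM] := @chain_sum_bounded R (pincr w) k l (fun _ _ => powR_ge0 _ _).
by exists M => _ [s ps <-]; rewrite pvar_sumE leM// last_rcons.
Qed.

Lemma powR_pvar w k l : pvar nm p w k l `^ p =
  sup [set pvar_sum nm p w k l s | s in [set s | incr_seq k l s]].
Proof.
rewrite powRVK ?gt_eqF//; apply: sup_ge0 => _ [s _ <-].
by rewrite sumr_ge0// => j _; rewrite powR_ge0.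
Qed.

Lemma pvarxx w k : pvar nm p w k k = 0.
Proof.
rewrite /pvar (_ : [set _ | _ in _] = set0) ?sup0 ?powR0 ?invr_eq0 ?gt_eqF//.
rewrite -subset0 => _ [s /= + _].
rewrite /incr_seq => /(order_path_min ltn_trans).
by rewrite all_rcons ltnn.
Qed.

Lemma chain_sum_le_pvar w k l t : path ltn k t -> last k t = l ->
  chain_sum (pincr w) k t <= pvar nm p w k l `^ p.
Proof.
case/lastP: t => [|s u] pt; first by rewrite chain_sum_nil powR_ge0.
rewrite last_rcons => ul; rewrite {u}ul in pt *.
rewrite powR_pvar; apply: ub_le_sup; first exact: pvar_sums_has_ubound.
by exists s => //; rewrite pvar_sumE.
Qed.

Lemma powR_pvar_le w k l M : (k <= l)%N ->
  (forall t, path ltn k t -> last k t = l -> chain_sum (pincr w) k t <= M) ->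
  pvar nm p w k l `^ p <= M.
Proof.
rewrite leq_eqVlt => /predU1P[<-|kl] leM.
  have := leM [::] isT erefl.
  by rewrite chain_sum_nil pvarxx powR0 ?gt_eqF.
rewrite powR_pvar; apply: ge_sup.
  by exists (pvar_sum nm p w k l [::]), [::] => //=; rewrite /incr_seq /= kl.
by move=> _ [s ps <-]; rewrite pvar_sumE leM// last_rcons.
Qed.

Lemma pcontrol_pvar w : pcontrol p (pvar nm p w).
Proof.
split=> [k l|k u l ku ul]; first exact: powR_ge0.
rewrite -lerBrDr; apply: powR_pvar_le => // t1 p1 l1.
rewrite lerBrDr addrC -lerBrDr; apply: powR_pvar_le => // t2 p2 l2.
rewrite lerBrDr addrC -[X in _ + chain_sum _ X _]l1 -chain_sum_cat.
by apply: chain_sum_le_pvar; rewrite ?cat_path ?p1 ?last_cat l1.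
Qed.

Lemma norm_le_pvar w a b : (a < b)%N -> nm (w b - w a) <= pvar nm p w a b.
Proof.
move=> ab; rewrite -(gt0_ler_powR2r p_gt0)// ?powR_ge0//.
have := @chain_sum_le_pvar w a b [:: b].
by rewrite chain_sum_cons chain_sum_nil addr0 /= ab; exact.
Qed.

Lemma pvar_le_pcontrol w f k l : pcontrol p f -> (k <= l)%N ->
  (forall a b, (k <= a)%N -> (a < b)%N -> (b <= l)%N ->
     nm (w b - w a) <= f a b) ->
  pvar nm p w k l <= f k l.
Proof.
move=> [f0 fS] kl w_le; rewrite -(gt0_ler_powR2r p_gt0) ?powR_ge0//.
apply: powR_pvar_le => // t; apply: (chain_sum_le_superadditive fS).
  exact: powR_ge0.
by move=> a b ka ab bl; rewrite gt0_ler_powR2r// w_le.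
Qed.

(* The [p]-variations of [w] stopped at time [b] and of [w] started at time [b]
   are [p]-controls, and their sum dominates the increments of [w]. *)
Lemma pvar_triangle w a b c :
  1 <= p -> (forall u v, nm (u + v) <= nm u + nm v) ->
  (a <= b)%N -> (b <= c)%N ->
  pvar nm p w a c <= pvar nm p w a b + pvar nm p w b c.
Proof.
move=> p1 nmD ab bc.
pose f u v :=
  pvar nm p w (minn b u) (minn b v) + pvar nm p w (maxn b u) (maxn b v).
suff : pvar nm p w a c <= f a c.
  by rewrite /f (minn_idPr ab) (minn_idPl bc) (maxn_idPl ab) (maxn_idPr bc).
apply: pvar_le_pcontrol.
- apply: pcontrolD => //;
    by apply: (pcontrol_homo _ (pcontrol_pvar w)) => u v; lia.
- exact: leq_trans bc.
- move=> u v _ uv _; rewrite /f.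
  have [ub|bu] := ltnP u b; have [vb|bv] := leqP v b.
  + by rewrite pvarxx addr0 norm_le_pvar.
  + rewrite -(subrK (w b) (w v)) -addrA addrC; apply: le_trans (nmD _ _) _.
    by apply: lerD; exact: norm_le_pvar.
  + by have := leq_trans uv vb; rewrite ltnNge bu.
  + by rewrite pvarxx add0r norm_le_pvar.
Qed.

End PVariation.

Section Zeta.
Variable R : realType.
Implicit Types (s p : R) (m N : nat).

Lemma zetaNS N s : zetaN N.+1 s = zetaN N s + N.+1%:R `^ (- s).
Proof. exact: big_nat_recr. Qed.

Lemma zetaN0 s : zetaN 0 s = 0.
Proof. exact: big_geq. Qed.

Lemma zetaN_homo s : {homo (fun N => zetaN N s) : m N / (m <= N)%N >-> m <= N}.
Proof.
apply: homo_leq => [//|? ? ?|N]; first exact: le_trans.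
by rewrite zetaNS lerDl powR_ge0.
Qed.

Lemma CpN_ge0 p N : 0 <= CpN p N.
Proof. by rewrite mulr_ge0 ?powR_ge0// sumr_ge0// => j _; exact: powR_ge0. Qed.

Lemma CpN_gt0 p N : (0 < N)%N -> 0 < CpN p N.
Proof.
move=> N0; rewrite mulr_gt0 ?powR_gt0//.
by apply: lt_le_trans (zetaN_homo _ N0); rewrite zetaNS zetaN0 add0r powR1.
Qed.

End Zeta.

(* The triples overlap, but every other one of them gives consecutive intervals:
   hence the two terms on the right, one for each parity. *)
Lemma exists_light_triple (R : realDomainType) (om : nat -> nat -> R) k l b t :
  superadditive om -> (forall a b, 0 <= om a b) ->
  path ltn k (b :: t) -> last b t = l -> (0 < size t)%N ->
  exists t1 b' c t2, b :: t = t1 ++ b' :: c :: t2 /\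
    (size t)%:R * om (last k t1) c <= om k l + om b l.
Proof.
move=> omS om0; elim: t k b => // c [|d t] IH k b /= /andP[kb pt] tl _.
  exists [::], b, c, [::]; split=> //=.
  by rewrite -tl mul1r lerDl.
have [bc ct] := andP pt.
have cl : (c <= l)%N by rewrite -tl; exact: (@path_ltn_le_last c (d :: t)).
have [t1 [b' [c' [t2 [tE light]]]]] := IH b c pt tl isT.
rewrite /= in light.
have split_kl := omS k c l (ltnW (ltn_trans kb bc)) cl.
have [first_le|rest_lt] := leP (om k c) (om (last b t1) c').
  exists [::], b, c, (d :: t); split=> //=; rewrite mulrS mulrDl mul1r.
  have := ler_wpM2l (ler0n R (size t).+1) first_le; lra.
exists (b :: t1), b', c', t2; split; first by rewrite tE.
by rewrite /= mulrS mulrDl mul1r; lra.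
Qed.

Section DiscreteSewing.
Variables (R : realType) (V : zmodType) (nrm : V -> R) (q : R).
Variables (f : nat -> nat -> R) (J : nat -> nat -> V) (k l : nat).
Hypotheses (nrmD : forall u v, nrm (u + v) <= nrm u + nrm v) (q_gt0 : 0 < q).
Hypothesis f_ctrl : pcontrol q f.
Hypothesis defect_le : forall a b c, (k <= a)%N -> (a < b)%N -> (b < c)%N ->
  (c <= l)%N -> nrm (J a c - J a b - J b c) <= f a c.

Lemma exists_removable_point m t :
  path ltn k t -> last k t = l -> size t = m.+2 ->
  exists t', [/\ path ltn k t', last k t' = l, size t' = m.+1 &
    nrm (chain_sum J k t') <=
      nrm (chain_sum J k t) + 2 `^ q^-1 * m.+1%:R `^ (- q^-1) * f k l].
Proof.
have [f0 fS] := f_ctrl.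
case: t => // b0 t ch tl [sz].
have t_gt0 : (0 < size t)%N by rewrite sz.
have [t1 [b [c [t2 [tE]]]]] :=
  exists_light_triple fS (fun _ _ => powR_ge0 _ _) ch tl t_gt0.
set a := last k t1 => light.
have f_b0l : f b0 l <= f k l.
  move: ch tl => /andP[kb0 /path_ltn_le_last b0l] /= tl.
  by rewrite (pcontrol_mono q_gt0 f_ctrl) ?(ltnW kb0) -?tl.
rewrite tE; move: ch tl; rewrite tE cat_path last_cat /= -/a.
move=> /and4P[t1_ch ab bc t2_ch] tl.
have ka : (k <= a)%N by exact: path_ltn_le_last.
have cl : (c <= l)%N by rewrite -tl path_ltn_le_last.
exists (t1 ++ c :: t2); split.
- by rewrite cat_path t1_ch /= (ltn_trans ab bc).
- by rewrite last_cat.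
- by move: (congr1 size tE); rewrite /= !size_cat sz /=; lia.
have -> : chain_sum J k (t1 ++ c :: t2) =
    chain_sum J k (t1 ++ b :: c :: t2) + (J a c - J a b - J b c).
  rewrite !chain_sum_cat !chain_sum_cons -/a -[RHS]addrA; congr (_ + _).
  by rewrite [RHS]addrC -(addrA (J a c)) -opprD (addrA (J a b)) addrA subrK.
apply: le_trans (nrmD _ _) _; rewrite lerD2l.
apply: le_trans (defect_le ka ab bc cl) _.
apply: ler_powR_root => //; rewrite -sz; apply: le_trans light _.
by rewrite mulr_natl mulr2n lerD2l gt0_ler_powR2r.
Qed.

Lemma chain_sewing m t : path ltn k t -> last k t = l -> size t = m.+1 ->
  nrm (J k l) <= nrm (chain_sum J k t) + 2 `^ q^-1 * zetaN m q^-1 * f k l.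
Proof.
elim: m t => [|m IH] t pt tl tm.
  case: t pt tl tm => [|u [|]]//= _ -> _.
  by rewrite chain_sum_cons chain_sum_nil addr0 zetaN0 mulr0 mul0r addr0.
have [t' [pt' tl' sz' t'_le]] := exists_removable_point pt tl tm.
have := IH t' pt' tl' sz'; rewrite zetaNS; lra.
Qed.

Lemma discrete_sewing : (k < l)%N -> nrm 0 = 0 ->
  (forall a, (k <= a)%N -> (a < l)%N -> J a a.+1 = 0) ->
  nrm (J k l) <= 2 `^ q^-1 * zetaN (l - k).-1 q^-1 * f k l.
Proof.
move=> kl nrm0 J_step; have lkE : (l - k).-1.+1 = (l - k)%N.
  by rewrite prednK// subn_gt0.
have := @chain_sewing (l - k).-1 (iota k.+1 (l - k)).
rewrite last_iota chain_sum_iota size_iota lkE subnKC ?(ltnW kl)//.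
rewrite big_nat_cond big1 => [|a /andP[/andP[ka al] _]]; last exact: J_step.
by rewrite nrm0 add0r; apply => //; exact: (iota_ltn_sorted k (l - k).+1).
Qed.

End DiscreteSewing.

Lemma exists_upcrossing (R : realDomainType) (h : nat -> R) (c : R) k l :
  (k <= l)%N -> h k <= c -> c < h l ->
  exists u, [/\ (k <= u < l)%N, h u <= c & c < h u.+1].
Proof.
move=> + hk; elim: l => [|l IH].
  by rewrite leqn0 => /eqP<-; rewrite ltNge hk.
rewrite leq_eqVlt => /predU1P[<-|kl cS]; first by rewrite ltNge hk.
have [hl|hl] := leP (h l) c; first by exists l; rewrite ltnSn andbT.
have [u [/andP[ku ul] hu huS]] := IH kl hl.
by exists u; rewrite ku ltnS (ltnW ul).
Qed.

Lemma ler_eighth_powR (R : realType) (p r : R) : p <= 2 -> 0 <= r <= 1 ->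
  r <= 8^-1 + 2 * r `^ p.
Proof.
move=> p2 /andP[+ r1]; rewrite le_eqVlt => /predU1P[<-|r0].
  by have := powR_ge0 0 p; lra.
have : r `^ 2 <= r `^ p by apply: ger_powR; rewrite ?r0.
rewrite powR_mulrn ?(ltW r0)//; have := sqr_ge0 (r - 4^-1); lra.
Qed.

Section SubadditiveLePControl.
Variables (R : realType) (p : R) (N : nat) (Y Om : nat -> nat -> R).
Hypotheses (p_ge1 : 1 <= p) (p_le2 : p <= 2).
Hypothesis Om_ctrl : pcontrol p Om.
Hypothesis Y_subadditive : forall a b c,
  (a <= b)%N -> (b <= c)%N -> Y a c <= Y a b + Y b c.
Hypothesis Y_step : forall u, (u < N)%N -> Y u u.+1 <= Om u u.+1 / 2.
Hypothesis Y_small : forall a b, (a <= b)%N -> (b <= N)%N ->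
  Om a b <= 1 -> Y a b <= Om a b.

(* [l] is reached by successive blocks, each the shortest one on which [Om]
   exceeds 1. Such a block contributes at most [3/2 Om^p], and the tail, where
   [Om <= 1], at most [1/8 + 2 Om^p]; the 1/8 fits in the [1/2 Om^p] that is
   left over from the block before it. *)
Lemma subadditive_le_pcontrol k l : (k <= l)%N -> (l <= N)%N -> 1 < Om k l ->
  Y k l <= 2 * Om k l `^ p.
Proof.
have p0 : 0 < p by exact: lt_le_trans p_ge1.
have [m] := ubnP (l - k); elim: m k => // m IH k klm kl lN Om1.
have Omkk : Om k k <= 1 by rewrite (pcontrol_diag _ p0 Om_ctrl).
have [u [/andP[ku ul] Omu OmuS]] := exists_upcrossing kl Omkk Om1.
have block : Y k u.+1 <= 3 / 2 * Om k u.+1 `^ p.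
  have := Y_small ku (ltnW (leq_trans ul lN)) Omu.
  have := Y_step (leq_trans ul lN); have := Y_subadditive ku (leqnSn u).
  have := pcontrol_mono p0 Om_ctrl ku (leqnSn u) (leqnn u.+1).
  have := le1r_powR (ltW OmuS) p_ge1; lra.
have tail : Y u.+1 l <= 8^-1 + 2 * Om u.+1 l `^ p.
  have [Oml|Oml] := leP (Om u.+1 l) 1; last first.
    by apply: le_trans (IH u.+1 _ ul lN Oml) _; [lia|rewrite lerDr].
  apply: le_trans (Y_small ul lN Oml) (ler_eighth_powR p_le2 _).
  by rewrite (pcontrol_ge0 _ _ Om_ctrl).
have := Om_ctrl.2 k u.+1 l (leqW ku) ul.
have := Y_subadditive (leqW ku) ul.
have := le1r_powR (ltW OmuS) p_ge1; lra.
Qed.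

End SubadditiveLePControl.

Section SelfBoundedVariation.
Variables (R : realType) (p C F : R) (N : nat) (X W : nat -> nat -> R).
Hypotheses (p_ge1 : 1 <= p) (p_le2 : p <= 2) (C_gt0 : 0 < C) (F_ge0 : 0 <= F).
Hypotheses (X_ge0 : forall a b, 0 <= X a b) (W_ctrl : pcontrol p W).
Hypothesis X_subadditive : forall a b c,
  (a <= b)%N -> (b <= c)%N -> X a c <= X a b + X b c.
Hypothesis X_unit_step : forall u, (u < N)%N -> X u u.+1 <= F * W u u.+1.
Hypothesis X_self_bound : forall a b, (a <= b)%N -> (b <= N)%N ->
  X a b <= F * (1 + C * X a b) * W a b.

Let Om a b := 2 * C * F * W a b.

Lemma self_bounded_small_variation a b : (a <= b)%N -> (b <= N)%N ->
  Om a b <= 1 -> C * X a b <= Om a b.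
Proof.
move=> ab bN Om1; have CX0 : 0 <= C * X a b by rewrite mulr_ge0// ltW.
have := ler_wpM2l (ltW C_gt0) (X_self_bound ab bN).
have := ler_wpM2r CX0 Om1; rewrite /Om; lra.
Qed.

Lemma self_bounded_large_variation k l : (k <= l)%N -> (l <= N)%N ->
  1 < Om k l -> C * X k l <= 2 * Om k l `^ p.
Proof.
have Om_ctrl : pcontrol p Om.
  by apply: pcontrolZ W_ctrl; rewrite !mulr_ge0// ltW.
apply: (@subadditive_le_pcontrol _ p N (fun a b => C * X a b)) => //.
- move=> a b c ab bc.
  by rewrite -mulrDr (ler_wpM2l (ltW C_gt0))// X_subadditive.
- move=> u uN.
  by have := ler_wpM2l (ltW C_gt0) (X_unit_step uN); rewrite /Om; lra.
- exact: self_bounded_small_variation.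
Qed.

Lemma self_bounded_variation_le k l : (k <= l)%N -> (l <= N)%N ->
  X k l <= 2 * Num.max (2 `^ p * C `^ (p - 1) * F `^ p * W k l `^ p)
                       (2 * F * W k l).
Proof.
move=> kl lN; have W0 : 0 <= W k l by exact: pcontrol_ge0 W_ctrl.
have p_gt0 : 0 < p by exact: lt_le_trans p_ge1.
set large := 2 `^ p * _ * _ * _; set small := 2 * F * W k l.
have OmE : Om k l = C * small by rewrite /Om /small; ring.
have OmpE : Om k l `^ p = C * large.
  rewrite /Om !powRM ?mulr_ge0 ?(ltW C_gt0)//.
  by rewrite -(mulr_powRB1 (ltW C_gt0) p_gt0) /large; ring.
have small0 : 0 <= small by rewrite !mulr_ge0.
rewrite -(ler_pM2l C_gt0) mulrCA; have [Om1|Om1] := leP (Om k l) 1.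
  apply: le_trans (self_bounded_small_variation kl lN Om1) _.
  have CS0 : 0 <= C * small by rewrite mulr_ge0// ltW.
  rewrite OmE; apply: (@le_trans _ _ (2 * (C * small))).
    by rewrite ler_peMl ?ler1n.
  by rewrite !ler_pM2l// le_max lexx orbT.
apply: le_trans (self_bounded_large_variation kl lN Om1) _.
by rewrite OmpE !ler_pM2l// le_max lexx.
Qed.

End SelfBoundedVariation.

Lemma locally_nonincreasing_le (R : realType) (u : R -> R) (a b : R) : a <= b ->
  (forall t, a <= t <= b ->
     \forall s \near t, (t <= s -> u s <= u t) /\ (s <= t -> u t <= u s)) ->
  u b <= u a.
Proof.
move=> ab u_dec; pose A := [set t | a <= t <= b /\ u t <= u a].
have Aa : A a by rewrite /A /= lexx ab.
have Aub : has_ubound A by exists b => t [/andP[]].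
have supA : has_sup A by split=> //; exists a.
have aT : a <= sup A by exact: ub_le_sup.
have Tb : sup A <= b by apply: ge_sup; [exists a|move=> t [/andP[]]].
have aTb : a <= sup A <= b by rewrite aT.
have /nbhs_ballP[e /= e0 u_near] := u_dec (sup A) aTb.
have uT : u (sup A) <= u a.
  have [t At Tt] := sup_adherent e0 supA.
  have tT : t <= sup A by exact: ub_le_sup.
  case: (At) => _; apply: le_trans.
  have [] := u_near t; last by move=> _; exact.
  by rewrite /ball /= ger0_norm ?subr_ge0//; lra.
have [Tb'|bT] := ltP (sup A) b; last by rewrite (@le_anti _ _ b (sup A)) ?bT.
pose s := Num.min b (sup A + e / 2).
have Ts : sup A < s by rewrite lt_min Tb' /= ltrDl divr_gt0.
have As : A s.
  split; first by rewrite ge_min lexx (le_trans aT (ltW Ts)).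
  apply: le_trans uT.
  have [] := u_near s; last by move=> + _; apply; exact: ltW.
  rewrite /ball /= ler0_norm ?subr_le0 ?(ltW Ts)//.
  have : s <= sup A + e / 2 by rewrite ge_min lexx orbT.
  lra.
by have := ub_le_sup Aub As; rewrite leNgt Ts.
Qed.

Section Norm.
Variables (R : realType) (V : lmodType R) (nrm : V -> R).
Hypothesis nrm_norm : is_norm nrm.

Lemma is_normD u v : nrm (u + v) <= nrm u + nrm v.
Proof. by case: nrm_norm. Qed.

Lemma is_normZ a u : nrm (a *: u) = `|a| * nrm u.
Proof. by case: nrm_norm. Qed.

Lemma is_norm0 : nrm 0 = 0.
Proof. by rewrite -(scale0r 0) is_normZ normr0 mul0r. Qed.

Lemma is_norm0_eq0 u : nrm u = 0 -> u = 0.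
Proof. by case: nrm_norm => _ _; exact. Qed.

Lemma is_normN u : nrm (- u) = nrm u.
Proof. by rewrite -scaleN1r is_normZ normrN normr1 mul1r. Qed.

Lemma is_norm_distrC u v : nrm (u - v) = nrm (v - u).
Proof. by rewrite -is_normN opprB. Qed.

Lemma is_norm_ge0 u : 0 <= nrm u.
Proof. have := is_normD u (- u); rewrite subrr is_norm0 is_normN; lra. Qed.

Lemma is_norm_distD v u w : nrm (u - w) <= nrm (u - v) + nrm (v - w).
Proof. by have := is_normD (u - v) (v - w); rewrite addrA subrK. Qed.

Lemma is_norm_sum (I : Type) (r : seq I) (P : pred I) (F : I -> V) :
  nrm (\sum_(i <- r | P i) F i) <= \sum_(i <- r | P i) nrm (F i).
Proof.
elim/big_ind2 : _ => [|u a v b ua vb|//]; first by rewrite is_norm0.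
exact: le_trans (is_normD _ _) (lerD ua vb).
Qed.

Lemma is_norm_lincomb d (c : 'rV[R]_d) (v : 'I_d -> V) (K : R) :
  (forall i, nrm (v i) <= K) ->
  nrm (\sum_(i < d) c ord0 i *: v i) <= K * l1norm c.
Proof.
move=> vK; apply: le_trans (is_norm_sum _ _ _) _.
by rewrite mulr_sumr; apply: ler_sum => i _; rewrite is_normZ mulrC ler_wpM2r.
Qed.

End Norm.

Lemma is_norm_le_mx_norm (R : realType) n (nrm : 'rV[R]_n -> R) : is_norm nrm ->
  exists2 K, 0 <= K & forall u, nrm u <= K * `|u|.
Proof.
move=> nrm_norm; exists (\sum_(i < n) nrm (delta_mx 0 i)).
  by rewrite sumr_ge0// => i _; exact: is_norm_ge0.
move=> u; rewrite {1}[u]row_sum_delta.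
apply: le_trans (is_norm_sum nrm_norm _ _ _) _.
rewrite mulr_suml; apply: ler_sum => i _.
rewrite (is_normZ nrm_norm) mulrC ler_wpM2l ?is_norm_ge0//.
rewrite [leRHS]/Num.norm/= mx_normrE.
exact: (le_bigmax _ (fun i : 'I_1 * 'I_n => `|u i.1 i.2|) (0, i)).
Qed.

Section MeanValueInequality.
Variables (R : realType) (V : normedModType R) (nrm : V -> R) (K : R).
Hypotheses (nrm_norm : is_norm nrm) (K_ge0 : 0 <= K).
Hypothesis nrm_le : forall u, nrm u <= K * `|u|.
Implicit Types (phi : R -> V).

Lemma near_increment_le phi (t M : R) :
  derivable phi t 1 -> nrm ('D_1 phi t) < M ->
  \forall s \near t, nrm (phi s - phi t) <= M * `|s - t|.
Proof.
move=> dphi ltM; have K1_gt0 : 0 < K + 1 by rewrite ltr_wpDl.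
have e0 : 0 < (M - nrm ('D_1 phi t)) / (K + 1) by rewrite divr_gt0// subr_gt0.
have /cvgrPdist_lt/(_ _ e0)/nbhs_ballP[r /= r0 near_t] := dphi.
apply/nbhs_ballP; exists r => //= s str.
have [->|st] := eqVneq s t.
  by rewrite !subrr normr0 mulr0 (is_norm0 nrm_norm).
pose h := s - t; have h0 : h != 0 by rewrite subr_eq0.
rewrite /ball /= distrC in str; have := near_t h _ h0.
rewrite /ball /= sub0r normrN => /(_ str) /ltW.
rewrite -/(derive phi t 1) scaler1 subrK ler_pdivlMr//.
set D := 'D_1 phi t; set err := D - _ => err_le.
have -> : phi s - phi t = h *: (D - err).
  by rewrite subKr scalerA divff// scale1r.
rewrite (is_normZ nrm_norm) mulrC ler_wpM2r//.
apply: le_trans (is_normD nrm_norm _ _) _; rewrite (is_normN nrm_norm).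
rewrite -lerBrDl; apply: le_trans (nrm_le _) _; apply: le_trans err_le.
by rewrite mulrC ler_wpM2l// lerDl.
Qed.

Lemma mean_value_le phi (a b M : R) : a <= b ->
  (forall t, a <= t <= b -> derivable phi t 1) ->
  (forall t, a <= t <= b -> nrm ('D_1 phi t) <= M) ->
  nrm (phi b - phi a) <= M * (b - a).
Proof.
move=> + dphi leM; rewrite le_eqVlt => /predU1P[<-|ab].
  by rewrite !subrr mulr0 (is_norm0 nrm_norm).
have ba : 0 < b - a by rewrite subr_gt0.
rewrite -ler_pdivrMr//; apply/ler_addgt0Pr => e e0; rewrite ler_pdivrMr//.
pose u (t : R) := nrm (phi t - phi a) - (M + e) * (t - a).
suff : u b <= u a.
  rewrite /u !subrr mulr0 (is_norm0 nrm_norm). lra.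
apply: locally_nonincreasing_le => [|t tab]; first exact: ltW.
have ltMe : nrm ('D_1 phi t) < M + e.
  by apply: le_lt_trans (leM t tab) _; rewrite ltrDl.
apply: filterS (near_increment_le (dphi t tab) ltMe) => s.
have := is_norm_distD nrm_norm (phi s) (phi t) (phi a).
have := is_norm_distD nrm_norm (phi t) (phi s) (phi a).
rewrite (is_norm_distrC nrm_norm (phi t) (phi s)) /u.
move=> tri1 tri2 incr; split=> [ts|st].
  by rewrite ger0_norm ?subr_ge0// in incr; lra.
by rewrite ler0_norm ?subr_le0// in incr; lra.
Qed.

Variables (U : normedModType R) (nrmU : U -> R).

Lemma differentiable_lipschitz (g : U -> V) (L : R) :
  (forall x, differentiable g x) ->
  (forall x v, nrm ('d g x v) <= L * nrmU v) ->
  forall x y, nrm (g y - g x) <= L * nrmU (y - x).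
Proof.
move=> dg gL x y; set v := y - x; pose line (t : R) := t *: v + x.
have lineE t :
    (fun h => h^-1 *: (((g \o line) \o shift t) (h *: 1) - (g \o line) t)) =
    (fun h => h^-1 *: ((g \o shift (line t)) (h *: v) - g (line t))).
  by apply/funext => h; rewrite /= /line scaler1 scalerDl addrA.
have -> : g y - g x = (g \o line) 1 - (g \o line) 0.
  by rewrite /= /line scale1r scale0r add0r subrK.
rewrite -[leRHS]mulr1 -[X in _ * X](subr0 1); apply: mean_value_le => // t _.
  by rewrite /derivable lineE; exact: diff_derivable.
by rewrite /derive lineE -/(derive g (line t) v) deriveE.
Qed.

End MeanValueInequality.

Section C1b.
Variables (R : realType) (n : nat) (nrm : 'rV[R]_n -> R).
Hypothesis nrm_norm : is_norm nrm.

Lemma opnorm_ubound (L : 'rV[R]_n -> 'rV[R]_n) (M : R) :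
  (forall v, nrm (L v) <= M * nrm v) ->
  ubound [set nrm (L v) | v in [set v | nrm v <= 1]] `|M|.
Proof.
move=> LM _ [v /= v1 <-].
apply: le_trans (LM v) _; apply: le_trans (ler_norm _) _.
by rewrite normrM ler_piMr// ger0_norm ?is_norm_ge0.
Qed.

Lemma opnorm_le (L : 'rV[R]_n -> 'rV[R]_n) (M : R) :
  (forall v, nrm (L v) <= M * nrm v) -> opnorm nrm L <= `|M|.
Proof.
move=> LM; apply: ge_sup (opnorm_ubound LM).
by exists (nrm (L 0)), 0; rewrite //= (is_norm0 nrm_norm).
Qed.

Lemma is_norm_le_opnorm (L : {linear 'rV[R]_n -> 'rV[R]_n}) (M : R) v :
  (forall v, nrm (L v) <= M * nrm v) -> nrm (L v) <= opnorm nrm L * nrm v.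
Proof.
move=> LM; have [v0|v0] := eqVneq (nrm v) 0.
  by rewrite (is_norm0_eq0 nrm_norm v0) linear0 (is_norm0 nrm_norm) mulr0.
have {}v0 : 0 < nrm v by rewrite lt_neqAle eq_sym v0 is_norm_ge0.
have nrmV : `|(nrm v)^-1| = (nrm v)^-1 by rewrite ger0_norm// invr_ge0 ltW.
rewrite -ler_pdivrMr// mulrC -nrmV -(is_normZ nrm_norm) -linearZ.
apply: ub_le_sup; first by exists `|M|; exact: opnorm_ubound.
exists ((nrm v)^-1 *: v) => //=.
by rewrite (is_normZ nrm_norm) nrmV mulVf// gt_eqF.
Qed.

Lemma C1b_le_supnorm (g : 'rV[R]_n -> 'rV[R]_n) x :
  C1b nrm g -> nrm (g x) <= supnorm nrm g.
Proof.
case=> _ _ [M leM] _; apply: ub_le_sup; last by exists x.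
by exists M => _ [y _ <-].
Qed.

Lemma C1b_le_dsupnorm (g : 'rV[R]_n -> 'rV[R]_n) x v : C1b nrm g ->
  nrm ('d g x v) <= dsupnorm nrm g * nrm v.
Proof.
case=> _ _ _ [M leM]; apply: le_trans (is_norm_le_opnorm v (leM x)) _.
rewrite ler_wpM2r ?is_norm_ge0//; apply: ub_le_sup; last by exists x.
by exists `|M| => _ [y _ <-]; exact: opnorm_le.
Qed.

Variables (d : nat) (f : 'I_d -> 'rV[R]_n -> 'rV[R]_n).
Hypothesis fC1b : forall mu, C1b nrm (f mu).

Lemma C1b_norm_ge0 : 0 <= C1b_norm nrm f.
Proof. exact: bigmax_ge_id. Qed.

Lemma is_norm_le_C1b_norm mu y : nrm (f mu y) <= C1b_norm nrm f.
Proof.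
apply: le_trans (C1b_le_supnorm y (fC1b mu)) _.
by apply: (bigmax_sup mu) => //; rewrite le_max lexx.
Qed.

Lemma C1b_norm_lipschitz mu y z :
  nrm (f mu z - f mu y) <= C1b_norm nrm f * nrm (z - y).
Proof.
have [K K0 nrm_le] := is_norm_le_mx_norm nrm_norm.
apply: (differentiable_lipschitz nrm_norm K0 nrm_le); first by case: (fC1b mu).
move=> u v; apply: le_trans (C1b_le_dsupnorm u v (fC1b mu)) _.
rewrite ler_wpM2r ?is_norm_ge0//.
by apply: (bigmax_sup mu) => //; rewrite le_max lexx orbT.
Qed.

End C1b.

Section DifferenceEquation.
Variables (R : realType) (V : lmodType R) (nrm : V -> R) (d : nat).
Variables (f : 'I_d -> V -> V) (F : R).
Hypotheses (nrm_norm : is_norm nrm) (F_ge0 : 0 <= F).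
Hypothesis f_bounded : forall mu y, nrm (f mu y) <= F.
Hypothesis f_lipschitz : forall mu y z,
  nrm (f mu z - f mu y) <= F * nrm (z - y).

Definition drift (c : 'rV[R]_d) (y : V) : V :=
  \sum_(mu < d) c ord0 mu *: f mu y.

Lemma driftD c1 c2 y : drift (c1 + c2) y = drift c1 y + drift c2 y.
Proof. by rewrite -big_split; apply: eq_bigr => mu _; rewrite mxE scalerDl. Qed.

Lemma l1norm_ge0 (c : 'rV[R]_d) : 0 <= l1norm c.
Proof. exact: sumr_ge0. Qed.

Lemma is_norm_drift c y : nrm (drift c y) <= F * l1norm c.
Proof. exact: is_norm_lincomb. Qed.

Lemma drift_lipschitz c y z :
  nrm (drift c z - drift c y) <= F * nrm (z - y) * l1norm c.
Proof.
rewrite -sumrB; under eq_bigr do rewrite -scalerBr.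
by apply: is_norm_lincomb => // mu; exact: f_lipschitz.
Qed.

Variables (p : R) (N : nat) (w : nat -> 'rV[R]_d) (x : nat -> V).
Hypothesis p_ge1 : 1 <= p.
Hypothesis x_step : forall k, (k < N)%N ->
  x k.+1 = x k + drift (w k.+1 - w k) (x k).

Local Notation X := (pvar nrm p x).
Local Notation W := (pvar (@l1norm R d) p w).
Local Notation C := (CpN p N).

Let p_gt0 : 0 < p. Proof. exact: lt_le_trans p_ge1. Qed.
Let nrm_ge0 v : 0 <= nrm v. Proof. exact: is_norm_ge0. Qed.
Let X_ctrl : pcontrol p X := pcontrol_pvar nrm p_gt0 x.
Let W_ctrl : pcontrol p W := pcontrol_pvar (@l1norm R d) p_gt0 w.
Let X_ge0 a b : 0 <= X a b. Proof. exact: pcontrol_ge0 X_ctrl. Qed.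
Let W_ge0 a b : 0 <= W a b. Proof. exact: pcontrol_ge0 W_ctrl. Qed.

Let x_incr_le a b : (a < b)%N -> nrm (x b - x a) <= X a b.
Proof. exact: norm_le_pvar. Qed.

Let w_incr_le a b : (a < b)%N -> l1norm (w b - w a) <= W a b.
Proof. by move=> ab; apply: norm_le_pvar => // v; exact: l1norm_ge0. Qed.

Definition remainder a b : V := x b - x a - drift (w b - w a) (x a).

Lemma remainder_step a : (a < N)%N -> remainder a a.+1 = 0.
Proof. by move=> aN; rewrite /remainder x_step// addrAC addrK subrr. Qed.

Lemma remainder_defectE a b c :
  remainder a c - remainder a b - remainder b c =
  drift (w c - w b) (x b) - drift (w c - w b) (x a).
Proof.
rewrite /remainder -[x c - x a](subrKA (x b)) -[w c - w a](subrKA (w b)).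
rewrite (driftD (w c - w b)) (opprD (drift _ _) (drift _ _)) addrACA addrK.
by rewrite opprB [LHS]addrC subrKA.
Qed.

Lemma remainder_defect_le a b c : (a < b)%N -> (b < c)%N ->
  nrm (remainder a c - remainder a b - remainder b c) <= F * (X a c * W a c).
Proof.
move=> ab bc; rewrite remainder_defectE.
apply: le_trans (drift_lipschitz _ _ _) _.
rewrite -mulrA ler_wpM2l// ler_pM ?l1norm_ge0//.
  apply: le_trans (x_incr_le ab) _.
  exact: pcontrol_mono p_gt0 X_ctrl (leqnn a) (ltnW ab) (ltnW bc).
apply: le_trans (w_incr_le bc) _.
exact: pcontrol_mono p_gt0 W_ctrl (ltnW ab) (ltnW bc) (leqnn c).
Qed.

Lemma remainder_le a b : (a < b)%N -> (b <= N)%N ->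
  nrm (remainder a b) <= C * (F * (X a b * W a b)).
Proof.
move=> ab bN; have q_gt0 : 0 < p / 2 by rewrite divr_gt0.
have XW_ctrl : pcontrol (p / 2) (fun a b => F * (X a b * W a b)).
  apply: pcontrolZ => //; apply: (pcontrolM p_gt0 p_gt0 _ X_ctrl W_ctrl).
  by rewrite invf_div; field; rewrite gt_eqF.
have := discrete_sewing (is_normD nrm_norm) q_gt0 XW_ctrl
  (fun _ _ _ _ ij jk _ => remainder_defect_le ij jk) ab (is_norm0 nrm_norm)
  (fun _ _ ib => remainder_step (leq_trans ib bN)).
rewrite invf_div => /le_trans; apply; rewrite ler_wpM2r ?mulr_ge0//.
by rewrite ler_wpM2l ?powR_ge0//; apply: zetaN_homo; lia.
Qed.

Lemma pvar_solution_self_bound a b : (a <= b)%N -> (b <= N)%N ->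
  X a b <= F * (1 + C * X a b) * W a b.
Proof.
move=> ab bN; have C0 : 0 <= C by exact: CpN_ge0.
have FCX0 : 0 <= F * (1 + C * X a b) by rewrite mulr_ge0// addr_ge0// mulr_ge0.
apply: (pvar_le_pcontrol nrm_ge0 p_gt0 (pcontrolZ FCX0 W_ctrl) ab).
move=> i j ai ij jb.
have rem_le := remainder_le ij (leq_trans jb bN).
have drift_le : nrm (drift (w j - w i) (x i)) <= F * W i j.
  apply: le_trans (is_norm_drift _ _) _.
  by rewrite (ler_wpM2l F_ge0)// w_incr_le.
have X_le := pcontrol_mono p_gt0 X_ctrl ai (ltnW ij) jb.
rewrite -(subrK (drift (w j - w i) (x i)) (x j - x i)).
apply: le_trans (is_normD nrm_norm _ _) _.
apply: le_trans (lerD rem_le drift_le) _.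
rewrite mulrDr mulr1 mulrDl addrC lerD2l (mulrCA C) -(mulrA F) -(mulrA C).
apply: ler_wpM2l; first exact: F_ge0.
apply: ler_wpM2l; first exact: C0.
apply: ler_wpM2r; first exact: W_ge0.
exact: X_le.
Qed.

Lemma pvar_solution_unit_step u : (u < N)%N -> X u u.+1 <= F * W u u.+1.
Proof.
move=> uN.
apply: (pvar_le_pcontrol nrm_ge0 p_gt0 (pcontrolZ F_ge0 W_ctrl) (leqnSn u)).
move=> i j ui ij ju; have -> : i = u by lia.
have -> : j = u.+1 by lia.
rewrite x_step// [x u + _]addrC addrK; apply: le_trans (is_norm_drift _ _) _.
by rewrite (ler_wpM2l F_ge0)// w_incr_le.
Qed.

Lemma pvar_solution_le k l : p <= 2 -> (k < l)%N -> (l <= N)%N ->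
  X k l <= 2 * Num.max (2 `^ p * C `^ (p - 1) * F `^ p * W k l `^ p)
                       (2 * F * W k l).
Proof.
move=> p2 kl lN; have C0 : 0 < C.
  by apply: CpN_gt0; apply: leq_trans lN; exact: leq_trans kl.
apply: (self_bounded_variation_le p_ge1 p2 C0 F_ge0 X_ge0 W_ctrl) (ltnW kl) lN.
- move=> a b c ab bc.
  by apply: pvar_triangle ab bc => //; exact: is_normD.
- exact: pvar_solution_unit_step.
- exact: pvar_solution_self_bound.
Qed.

End DifferenceEquation.

Theorem theorem5p2 (R : realType) (p : R) (N d n : nat)
  (nrm : 'rV[R]_n -> R) (f : 'I_d -> 'rV[R]_n -> 'rV[R]_n)
  (w : nat -> 'rV[R]_d) (x : nat -> 'rV[R]_n) (xi : 'rV[R]_n) :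
  1 <= p -> p < 2 -> (1 <= d)%N -> (1 <= n)%N ->
  is_norm nrm ->
  (forall mu, C1b nrm (f mu)) ->
  x 0%N = xi ->
  (forall k, (k < N)%N ->
     x k.+1 = x k + \sum_(mu < d) (w k.+1 ord0 mu - w k ord0 mu) *: f mu (x k)) ->
  forall k l, (k < l)%N -> (l <= N)%N ->
  pvar nrm p x k l <=
  2 * Num.max
    (2 `^ p * (CpN p N) `^ (p - 1) * (C1b_norm nrm f) `^ p
       * (pvar (@l1norm R d) p w k l) `^ p)
    (2 * C1b_norm nrm f * pvar (@l1norm R d) p w k l).
Proof.
move=> p_ge1 p_lt2 _ _ nrm_norm fC1b _ xE k l kl lN.
have x_step i : (i < N)%N -> x i.+1 = x i + drift f (w i.+1 - w i) (x i).
  by move=> iN; rewrite xE//; congr (_ + _); apply: eq_bigr => mu _; rewrite !mxE.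
apply: (pvar_solution_le nrm_norm (C1b_norm_ge0 nrm f) _ _ p_ge1 x_step
  (ltW p_lt2) kl lN) => [mu y|mu y z].
- exact: is_norm_le_C1b_norm.
- exact: C1b_norm_lipschitz.
Qed.
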